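(* Let $K$ be a field of characteristic $0$ with algebraic closure $\overline K$. Let $p,q,r\in K$, let $g(y)=y^4+py^2+qy+r$, and define the cubic resolvent $$R(x)=x^3+2px^2+(p^2-4r)x-q^2.$$ Let the roots of $R$ in $\overline K$ (counted with multiplicity) be $u,v,w$, and let $\gamma_1=\sqrt u$, $\gamma_2=\sqrt v$, $\gamma_3=\sqrt w$ be square roots in $\overline K$, where the signs are chosen so that $\gamma_1\gamma_2\gamma_3=-q$. Then the roots of $g$ in $\overline K$ (counted with multiplicity) are given by $$\beta_1=\tfrac12(\gamma_1+\gamma_2+\gamma_3),\quad \beta_2=\tfrac12(\gamma_1-\gamma_2-\gamma_3),\quad \beta_3=\tfrac12(-\gamma_1+\gamma_2-\gamma_3),\quad \beta_4=\tfrac12(-\gamma_1-\gamma_2+\gamma_3).$$ Moreover, if $f(x)=x^4+bx^3+cx^2+dx+e$ with $b,c,d,e\in K$, and $g(y)=y^4+py^2+qy+r$ is defined by $g(y)=f(y-b/4)$, then the roots of $f$ (counted with multiplicity) are $\alpha_i=\beta_i-b/4$, $i=1,\dots,4$, where $\beta_1,\dots,\beta_4$ are the roots of $g$ given above.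
   Context: For $f(x)=x^4+bx^3+cx^2+dx+e$, the polynomial $f(y-b/4)$ is monic of degree 4 with no cubic term, so it has the form $y^4+py^2+qy+r$ with $p,q,r\in K$. *)

(* Defs.v *)
From mathcomp Require Import all_boot all_algebra.
Set Implicit Arguments.
Unset Strict Implicit.
Unset Printing Implicit Defensive.

Import GRing.Theory.
Local Open Scope ring_scope.

(* L, being a closedFieldType, is algebraically closed; what remains to be
   said is that it is algebraic over the image of K. *)
Definition algebraic_closure (K : fieldType) (L : closedFieldType)
    (iota : {rmorphism K -> L}) : Prop :=
  forall z : L, algebraicOver iota z.

(* s lists the roots of P in L, each repeated according to its multiplicity;
   only used for P != 0. *)
Definition roots_with_mult (L : fieldType) (P : {poly L}) (s : seq L) : Prop :=
  forall z : L, count_mem z s = mup z P.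

Definition quartic (K : nzRingType) (b c d e : K) : {poly K} :=
  'X^4 + b *: 'X^3 + c *: 'X^2 + d *: 'X + e%:P.

Definition depressed_quartic (K : nzRingType) (p q r : K) : {poly K} :=
  'X^4 + p *: 'X^2 + q *: 'X + r%:P.

Definition cubic_resolvent (K : nzRingType) (p q r : K) : {poly K} :=
  'X^3 + (2 * p) *: 'X^2 + (p ^+ 2 - 4 * r) *: 'X - (q ^+ 2)%:P.

Definition signed_sqrts (L : nzRingType) (q u v w g1 g2 g3 : L) : Prop :=
  [/\ g1 ^+ 2 = u, g2 ^+ 2 = v, g3 ^+ 2 = w & g1 * g2 * g3 = - q].

Definition quartic_roots (L : unitRingType) (g1 g2 g3 : L) : seq L :=
  [:: 2^-1 * (g1 + g2 + g3);
      2^-1 * (g1 - g2 - g3);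
      2^-1 * (- g1 + g2 - g3);
      2^-1 * (- g1 - g2 + g3)].

(* Main.v *)
Require Import Defs.
From mathcomp Require Import all_boot all_algebra.
From mathcomp Require Import ring.
Import GRing.Theory.
Local Open Scope ring_scope.

(** The substitution g_i = 2 h_i removes all denominators.  Vieta's formulas
    for the resolvent, whose roots are the g_i^2, express p and r through the
    elementary symmetric functions e1, e2 of the h_i^2, and the choice of signs
    gives q:
    - p = -2 e1, because 2 p is minus the sum of the roots 4 h_i^2;
    - r = e1^2 - 4 e2, because p^2 - 4 r = 16 e2;
    - q = -8 h1 h2 h3, because g1 g2 g3 = -q.
    On the other hand, the product of the four factors X - (+-h1 +-h2 +-h3),
    taken over the sign patterns with an even number of minus signs, expands to
    X^4 - 2 e1 X^2 - 8 h1 h2 h3 X + (e1^2 - 4 e2)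
    ([quartic_factorization]).  Hence the quartic with those p, q, r is exactly
    this product, and multiplicities are read off from the factorization,
    whether or not some of the roots coincide.

    Admissible signs exist because the three roots of the resolvent multiply to
    q^2, so that any choice of square roots has product q or -q, and in the
    first case flipping one of them repairs the sign.

    For the general quartic f, the equation g(y) = f(y - b/4) is inverted to
    f(x) = g(x + b/4), and substituting X + b/4 in a product of linear factors
    translates all roots by -b/4. *)

Lemma roots_with_mult_prod (L : fieldType) (s : seq L) :
  roots_with_mult (\prod_(a <- s) ('X - a%:P)) s.
Proof. by move=> z; rewrite mu_prod_XsubC. Qed.

(** Over a closed field P is a product of linear factors; multiplicities
    determine their list up to order, hence the product. *)
Lemma roots_with_multP (L : closedFieldType) (P : {poly L}) (s : seq L) :
  P \is monic -> roots_with_mult P s -> P = \prod_(a <- s) ('X - a%:P).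
Proof.
move=> /monicP monP rootsP; have [t] := closed_field_poly_normal P.
rewrite monP scale1r => defP; rewrite [LHS]defP; apply: perm_big.
by apply/allP=> z _ /=; rewrite rootsP -mu_prod_XsubC -defP.
Qed.

Lemma prod_XsubC_comp_XaddC (L : comNzRingType) (s : seq L) (a : L) :
  (\prod_(x <- s) ('X - x%:P)) \Po ('X + a%:P)
    = \prod_(x <- [seq x - a | x <- s]) ('X - x%:P).
Proof.
rewrite rmorph_prod /= big_map; apply: eq_bigr => x _.
by rewrite comp_polyB comp_polyX comp_polyC polyCB opprB addrA addrAC.
Qed.

Lemma monic_cubic_resolvent (R : nzRingType) (p q r : R) :
  cubic_resolvent p q r \is monic.
Proof.
rewrite monicE /cubic_resolvent -!addrA lead_coefDl ?lead_coefXn //.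
rewrite size_polyXn ltnS (leq_trans (size_polyD _ _)) // geq_max.
rewrite (leq_trans (size_scale_leq _ _)) ?size_polyXn //=.
rewrite (leq_trans (size_polyD _ _)) // geq_max size_polyN.
rewrite (leq_trans (size_scale_leq _ _)) ?size_polyX //=.
exact: leq_trans (size_polyC_leq1 _) _.
Qed.

Lemma map_cubic_resolvent (K L : nzRingType) (f : {rmorphism K -> L})
    (p q r : K) :
  map_poly f (cubic_resolvent p q r) = cubic_resolvent (f p) (f q) (f r).
Proof.
rewrite /cubic_resolvent rmorphB !rmorphD /= !map_polyZ !map_polyXn map_polyX.
by rewrite map_polyC /= rmorphB !rmorphXn !rmorphM !rmorph_nat.
Qed.

Lemma cubic_resolvent_Vieta (R : comNzRingType) (p q r u v w : R) :
  cubic_resolvent p q r = \prod_(a <- [:: u; v; w]) ('X - a%:P) ->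
  [/\ u + v + w = - (2 * p),
      u * v + u * w + v * w = p ^+ 2 - 4 * r
    & u * v * w = q ^+ 2].
Proof.
have -> : \prod_(a <- [:: u; v; w]) ('X - a%:P)
    = 'X^3 + (- (u + v + w)) *: 'X^2 + (u * v + u * w + v * w) *: 'X
      - (u * v * w)%:P :> {poly R}.
  by rewrite !big_cons big_nil -!mul_polyC !(polyCN, polyCD, polyCM); ring.
move=> eqP; have coef_eq i := congr1 (fun P : {poly R} => P`_i) eqP.
have simp := (mulr0, mulr1, addr0, add0r, subr0).
rewrite /cubic_resolvent in coef_eq; split.
- by move: (coef_eq 2%N); rewrite !coefE /= !simp => ->; rewrite opprK.
- by move: (coef_eq 1%N); rewrite !coefE /= !simp.
- by move: (coef_eq 0%N); rewrite !coefE /= !simp => /oppr_inj.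
Qed.

(** Any three square roots have product q or -q; negating one of them turns
    the first case into the second. *)
Lemma signed_sqrts_exist (L : closedFieldType) (q u v w : L) :
  u * v * w = q ^+ 2 -> exists g1 g2 g3, signed_sqrts q u v w g1 g2 g3.
Proof.
move=> uvw; have sqrtE (a : L) : exists g, g ^+ 2 = a.
  have [g] := solve_monicpoly (fun i => if i is 0%N then a else 0) (isT : 0 < 2)%N.
  by rewrite !big_ord_recl big_ord0 /= mul0r !addr0 mulr1; exists g.
have [[g1 g1u] [g2 g2v] [g3 g3w]] := And3 (sqrtE u) (sqrtE v) (sqrtE w).
have /eqP : (g1 * g2 * g3) ^+ 2 = q ^+ 2 by rewrite !exprMn g1u g2v g3w.
rewrite eqf_sqr => /orP[] /eqP g123; last by exists g1, g2, g3.
by exists g1, g2, (- g3); split; rewrite ?sqrrN // mulrN g123.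
Qed.

(** The h_i are the halves of the square roots, which makes the identity
    valid over any commutative ring. *)
Lemma quartic_factorization (R : comNzRingType) (h1 h2 h3 : R) :
  depressed_quartic (- (2 * (h1 ^+ 2 + h2 ^+ 2 + h3 ^+ 2)))
      (- (8 * (h1 * h2 * h3)))
      ((h1 ^+ 2 + h2 ^+ 2 + h3 ^+ 2) ^+ 2
        - 4 * (h1 ^+ 2 * h2 ^+ 2 + h1 ^+ 2 * h3 ^+ 2 + h2 ^+ 2 * h3 ^+ 2))
    = \prod_(x <- [:: h1 + h2 + h3; h1 - h2 - h3; - h1 + h2 - h3;
                     - h1 - h2 + h3]) ('X - x%:P).
Proof.
rewrite /depressed_quartic !big_cons big_nil -!mul_polyC.
have natC n : n%:R%:P = n%:R :> {poly R} by rewrite rmorph_nat.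
by rewrite !(natC, polyCN, polyCD, polyCM, polyC_exp); ring.
Qed.

(** Dividing Vieta's relations by 2 and 4 recovers p and r; q comes from the sign
    convention rather than from the product of the roots, which only gives
    q^2. *)
Lemma depressed_quartic_factorization (L : fieldType) (p q r u v w g1 g2 g3 : L) :
  2 != 0 :> L ->
  cubic_resolvent p q r = \prod_(a <- [:: u; v; w]) ('X - a%:P) ->
  signed_sqrts q u v w g1 g2 g3 ->
  depressed_quartic p q r = \prod_(x <- quartic_roots g1 g2 g3) ('X - x%:P).
Proof.
move=> nz2 /cubic_resolvent_Vieta[sum1 sum2 _] [g1u g2v g3w g123].
move: sum1 sum2 g123; rewrite -{u}g1u -{v}g2v -{w}g3w.
have double g : exists h : L, g = 2 * h by exists (2^-1 * g); rewrite mulVKf.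
have nz4 : 4 != 0 :> L by rewrite (_ : 4 = 2 * 2) ?mulf_neq0 // -natrM.
have [[h1 ->] [h2 ->] [h3 ->]] := And3 (double g1) (double g2) (double g3).
move=> sum1 sum2 g123.
have pE : p = - (2 * (h1 ^+ 2 + h2 ^+ 2 + h3 ^+ 2)).
  by apply: (mulfI nz2); apply: oppr_inj; rewrite -sum1; ring.
have qE : q = - (8 * (h1 * h2 * h3)).
  by apply: oppr_inj; rewrite -g123; ring.
have rE : r = (h1 ^+ 2 + h2 ^+ 2 + h3 ^+ 2) ^+ 2
    - 4 * (h1 ^+ 2 * h2 ^+ 2 + h1 ^+ 2 * h3 ^+ 2 + h2 ^+ 2 * h3 ^+ 2).
  apply: (mulfI nz4); have -> : 4 * r = p ^+ 2 - (p ^+ 2 - 4 * r) by ring.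
  by rewrite -sum2 pE; ring.
rewrite pE qE rE quartic_factorization /quartic_roots.
by rewrite -!mulrN -!mulrDr !mulKf.
Qed.

Lemma map_depressed_quartic (K L : nzRingType) (f : {rmorphism K -> L})
    (p q r : K) :
  map_poly f (depressed_quartic p q r) = depressed_quartic (f p) (f q) (f r).
Proof.
rewrite /depressed_quartic !rmorphD /= !map_polyZ !map_polyXn map_polyX.
by rewrite map_polyC.
Qed.

Theorem theorem3p2 (K : fieldType) (char0 : [pchar K] =i pred0)
    (L : closedFieldType) (iota : {rmorphism K -> L})
    (closureL : algebraic_closure iota)
    (p q r : K) (u v w : L)
    (rootsR : roots_with_mult (map_poly iota (cubic_resolvent p q r))
                [:: u; v; w]) :
  (exists g1 g2 g3 : L, signed_sqrts (iota q) u v w g1 g2 g3) /\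
  (forall g1 g2 g3 : L, signed_sqrts (iota q) u v w g1 g2 g3 ->
     roots_with_mult (map_poly iota (depressed_quartic p q r))
       (quartic_roots g1 g2 g3) /\
     (forall b c d e : K,
        depressed_quartic p q r = quartic b c d e \Po ('X - (b / 4)%:P) ->
        roots_with_mult (map_poly iota (quartic b c d e))
          [seq beta - iota (b / 4) | beta <- quartic_roots g1 g2 g3])).
Proof.
have nz2 : 2 != 0 :> L.
  by rewrite (pcharf0P _).1 // => i; rewrite (fmorph_pchar iota) char0.
move: rootsR; rewrite map_cubic_resolvent.
move=> /(roots_with_multP _ _ _ (monic_cubic_resolvent _ _ _ _)) splitR.
split=> [|g1 g2 g3 sqrt_g].
  have [_ _] := cubic_resolvent_Vieta _ _ _ _ _ _ _ splitR.
  exact: signed_sqrts_exist.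
have splitg :=
  depressed_quartic_factorization _ _ _ _ _ _ _ _ _ _ nz2 splitR sqrt_g.
rewrite map_depressed_quartic; split=> [|b c d e gE].
  by rewrite splitg; apply: roots_with_mult_prod.
(* Composing gE with X + b/4 undoes the translation by -b/4. *)
have := comp_polyXaddC_K (quartic b c d e) (- (b / 4)).
rewrite polyCN opprK -gE => <-.
rewrite map_comp_poly map_depressed_quartic splitg rmorphD /= map_polyX map_polyC.
by rewrite prod_XsubC_comp_XaddC; apply: roots_with_mult_prod.
Qed.
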